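(* Let $n_L\ge 4$ and let $\mathbf{s}_1,\ldots,\mathbf{s}_{n_L}\in\mathbb{R}^3$ be fixed points (landmarks), at least four of which are noncoplanar. Let $t_0<t_f$, let $\mathbf{u}$ be an $\mathbb{R}^3$-valued input signal, and let $r_1(t),\ldots,r_{n_L}(t)$ be the range signals produced, under the input $\mathbf{u}$, by a solution of the nonlinear system given in the context, where there is $r_m>0$ with $r_m\le r_i(t)$ for all $i$ and all $t>t_0$. Then the linear time-varying system $$\dot{\boldsymbol{x}}(t)=\mathbf{A}(t)\boldsymbol{x}(t)+\mathbf{B}\mathbf{u}(t),\qquad \mathbf{y}(t)=\mathbf{C}(t)\boldsymbol{x}(t),\qquad \boldsymbol{x}(t)\in\mathbb{R}^{13+n_L},$$ whose matrices $\mathbf{A}(t),\mathbf{B},\mathbf{C}(t)$ are built from the $\mathbf{s}_i$ and from the known signals $\mathbf{u}(t)$, $r_i(t)$ as described in the context, is observable on $[t_0,t_f]$.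
   Context: **Nonlinear system.** For $\mathbf{x}_1,\mathbf{x}_2,\mathbf{x}_3\in\mathbb{R}^3$ and input $\mathbf{u}(t)\in\mathbb{R}^3$ (say piecewise continuous): $$\dot{\mathbf{x}}_1=\mathbf{x}_2,\quad \dot{\mathbf{x}}_2=\mathbf{x}_3+\mathbf{u}(t),\quad \dot{\mathbf{x}}_3=\mathbf{0},\quad r_i(t)=\|\mathbf{s}_i-\mathbf{x}_1(t)\|,\ i=1,\ldots,n_L .$$ **Augmented linear time-varying (LTV) system.** The signals $\mathbf{u}(t)$ and $r_i(t)$ are fixed known functions of time (the $r_i$ being the ranges along a solution of the nonlinear system). The state is $$\boldsymbol{x}=[\mathbf{x}_1^T\ \mathbf{x}_2^T\ \mathbf{x}_3^T\ x_4\ \ldots\ x_{n_L+7}]^T\in\mathbb{R}^{13+n_L},$$ with $\mathbf{x}_1,\mathbf{x}_2,\mathbf{x}_3\in\mathbb{R}^3$ and $x_4,\ldots,x_{n_L+7}\in\mathbb{R}$, all treated as independent state variables (no algebraic relation among them, or between them and the signals $r_i(t)$, is imposed). The equation $\dot{\boldsymbol{x}}=\mathbf{A}(t)\boldsymbol{x}+\mathbf{B}\mathbf{u}$ is, written out, $$\dot{\mathbf{x}}_1=\mathbf{x}_2,\qquad \dot{\mathbf{x}}_2=\mathbf{x}_3+\mathbf{u}(t),\qquad \dot{\mathbf{x}}_3=\mathbf{0},$$ $$\dot x_{3+i}=-\frac{\mathbf{s}_i^T\mathbf{x}_2}{r_i(t)}+\frac{x_{n_L+4}}{r_i(t)},\quad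 i=1,\ldots,n_L,$$ $$\dot x_{n_L+4}=\mathbf{u}^T(t)\mathbf{x}_1+x_{n_L+5},\quad \dot x_{n_L+5}=2\mathbf{u}^T(t)\mathbf{x}_2+3x_{n_L+6},\quad \dot x_{n_L+6}=\mathbf{u}^T(t)\mathbf{x}_3+x_{n_L+7},\quad \dot x_{n_L+7}=0 .$$ Thus $\mathbf{B}=[\mathbf{0}\ \mathbf{I}\ \mathbf{0}\ 0\ \ldots\ 0]^T$, with the identity in the $\mathbf{x}_2$-block, and $\mathbf{A}(t)$ is the coefficient matrix of the homogeneous part. The output $\mathbf{y}=\mathbf{C}(t)\boldsymbol{x}\in\mathbb{R}^{n_L+n_L(n_L-1)/2}$ consists of $y_i=x_{3+i}$ for $i=1,\ldots,n_L$, followed by, for every pair $1\le i<j\le n_L$, the scalar $$\frac{2(\mathbf{s}_i-\mathbf{s}_j)\cdot\mathbf{x}_1}{r_i(t)+r_j(t)}+x_{3+i}-x_{3+j}.$$ **Observability.** The LTV system is observable on $[t_0,t_f]$ if its initial state $\boldsymbol{x}(t_0)$ is uniquely determined by the input and output on $[t_0,t_f]$; equivalently, the observability Gramian $\int_{t_0}^{t_f}\boldsymbol{\phi}^T(t,t_0)\mathbf{C}^T(t)\mathbf{C}(t)\boldsymbol{\phi}(t,t_0)\,dt$ is positive definite, where $\boldsymbol{\phi}$ is the transition matrix of $\mathbf{A}(t)$. *)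

(* Defs.v *)
From mathcomp Require Export all_boot all_order all_algebra.
From mathcomp Require Export all_classical all_reals all_analysis.
From mathcomp Require Import ring.
Export Order.TTheory GRing.Theory Num.Theory.
Export numFieldNormedType.Exports.

Set Implicit Arguments.
Unset Strict Implicit.
Unset Printing Implicit Defensive.

#[global] Open Scope classical_set_scope.
#[global] Open Scope ring_scope.

(** * Geometry of R^m *)

Definition dotv (R : realType) (m : nat) (v w : 'cV[R]_m) : R :=
  (v^T *m w) 0 0.

(* The library norm on matrices is the sup norm, hence this definition. *)
Definition enorm (R : realType) (m : nat) (v : 'cV[R]_m) : R :=
  Num.sqrt (dotv v v).

(* The points p i lie in the plane { q | a . q = c }, for some normal a <> 0. *)
Definition coplanar (R : realType) (k : nat) (p : 'I_k -> 'cV[R]_3) : Prop :=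
  exists a : 'cV[R]_3, a != 0 /\ exists c : R, forall i, dotv a (p i) = c.

Definition four_noncoplanar (R : realType) (n : nat) (s : 'I_n -> 'cV[R]_3) :=
  exists f : 'I_4 -> 'I_n, injective f /\ ~ coplanar (fun k => s (f k)).

(** * Signals and solutions of differential equations *)

(* Finitely many discontinuities, and finite one-sided limits everywhere. *)
Definition piecewise_continuous (R : realType) (a b : R) (f : R -> R) : Prop :=
  [/\ exists D : seq R, forall t, a < t < b -> t \notin D ->
        {for t, continuous f},
      forall t, a <= t < b -> cvg (f x @[x --> t^'+])
    & forall t, a < t <= b -> cvg (f x @[x --> t^'-])].

(* x solves x' = dx on [a, b]: since the right-hand sides of interest are only
   piecewise continuous in time, x is required to be continuous on [a, b] and
   to satisfy the equation except at finitely many instants. *)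
Definition solves (R : realType) (m : nat) (a b : R) (x dx : R -> 'cV[R]_m) :=
  forall k : 'I_m,
    {within `[a, b], continuous (fun t => x t k 0)} /\
    exists D : seq R, forall t, a < t < b -> t \notin D ->
      is_derive t (1 : R) (fun v => x v k 0) (dx t k 0).

(* Input signals on [t0, +oo[. *)
Definition input_signal (R : realType) (m : nat) (t0 : R) (u : R -> 'cV[R]_m) :=
  forall b, t0 < b -> forall k, piecewise_continuous t0 b (fun t => u t k 0).

(** * The nonlinear system *)

Definition nonlinear_solution (R : realType) (t0 : R)
    (u x1 x2 x3 : R -> 'cV[R]_3) : Prop :=
  forall b, t0 < b ->
    [/\ solves t0 b x1 x2,
        solves t0 b x2 (fun t => x3 t + u t)
      & solves t0 b x3 (fun=> 0)].

Definition range_signals (R : realType) (n : nat) (s : 'I_n -> 'cV[R]_3)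
    (t0 : R) (u : R -> 'cV[R]_3) (r : 'I_n -> R -> R) : Prop :=
  exists x1 x2 x3 : R -> 'cV[R]_3,
    nonlinear_solution t0 u x1 x2 x3 /\
    forall i t, t0 <= t -> r i t = enorm (s i - x1 t).

(** * Linear time-varying systems *)

Definition ltv_solution (R : realType) (N m : nat) (A : R -> 'M[R]_N)
    (B : 'M[R]_(N, m)) (u : R -> 'cV[R]_m) (t0 tf : R) (x : R -> 'cV[R]_N) :=
  solves t0 tf x (fun t => A t *m x t + B *m u t).

(* The initial state is determined by the input and the output. As A and C may
   themselves be built from the input signal, u is fixed. *)
Definition observable (R : realType) (N m p : nat) (A : R -> 'M[R]_N)
    (B : 'M[R]_(N, m)) (C : R -> 'M[R]_(p, N)) (u : R -> 'cV[R]_m)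
    (t0 tf : R) : Prop :=
  forall x z : R -> 'cV[R]_N,
    ltv_solution A B u t0 tf x -> ltv_solution A B u t0 tf z ->
    (forall t, t0 <= t <= tf -> C t *m x t = C t *m z t) ->
    x t0 = z t0.

(** * The augmented system *)

(* The state is split into the blocks x1, x2, x3 in R^3, (x_4, ..., x_{n+3}) in
   R^n, and (x_{n+4}, ..., x_{n+7}) in R^4. *)
Definition state_dim (n : nat) : nat := (3 + (3 + (3 + (n + 4))))%N.

Lemma state_dimE n : state_dim n = (13 + n)%N.
Proof. by rewrite /state_dim (addnC n) !addnA. Qed.

Definition col5 (R : realType) (n q : nat) (a b c : 'M[R]_(3, q))
    (d : 'M[R]_(n, q)) (e : 'M[R]_(4, q)) : 'M[R]_(state_dim n, q) :=
  col_mx a (col_mx b (col_mx c (col_mx d e))).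

Definition row5 (R : realType) (n q : nat) (a b c : 'M[R]_(q, 3))
    (d : 'M[R]_(q, n)) (e : 'M[R]_(q, 4)) : 'M[R]_(q, state_dim n) :=
  row_mx a (row_mx b (row_mx c (row_mx d e))).

(* The coordinate direction of x_{n+4+i}, for i < 4. *)
Definition e4 (R : realType) (i : nat) : 'cV[R]_4 := delta_mx (inord i) 0.

Definition Amx (R : realType) (n : nat) (s : 'I_n -> 'cV[R]_3)
    (u : R -> 'cV[R]_3) (r : 'I_n -> R -> R) (t : R) : 'M[R]_(state_dim n) :=
  col5
    (row5 0 1%:M 0 0 0)
    (row5 0 0 1%:M 0 0)
    0
    (row5 0 (\matrix_(i < n, k < 3) (- s i k 0 / r i t)) 0
          0 (\matrix_(i < n, l < 4) ((l == 0)%:R / r i t)))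
    (row5 (e4 R 0 *m (u t)^T)
          (2 *: (e4 R 1 *m (u t)^T))
          (e4 R 2 *m (u t)^T)
          0
          (e4 R 0 *m (e4 R 1)^T + 3 *: (e4 R 1 *m (e4 R 2)^T)
           + e4 R 2 *m (e4 R 3)^T)).

Definition Bmx (R : realType) (n : nat) : 'M[R]_(state_dim n, 3) :=
  col5 0 1%:M 0 0 0.

Definition ltpairs (n : nat) : {set 'I_n * 'I_n} :=
  [set p : 'I_n * 'I_n | (p.1 < p.2)%N].

Definition pair_fst (n : nat) (k : 'I_#|ltpairs n|) : 'I_n := (enum_val k).1.
Definition pair_snd (n : nat) (k : 'I_#|ltpairs n|) : 'I_n := (enum_val k).2.

(* The rows are indexed by the landmarks, then by the pairs i < j. *)
Definition Cmx (R : realType) (n : nat) (s : 'I_n -> 'cV[R]_3)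
    (r : 'I_n -> R -> R) (t : R) : 'M[R]_(n + #|ltpairs n|, state_dim n) :=
  col_mx
    (row5 0 0 0 1%:M 0)
    (row5
      (\matrix_(k < #|ltpairs n|, c < 3)
         (2 * (s (pair_fst k) - s (pair_snd k)) c 0
          / (r (pair_fst k) t + r (pair_snd k) t)))
      0 0
      (\matrix_(k < #|ltpairs n|, l < n)
         ((l == pair_fst k)%:R - (l == pair_snd k)%:R))
      0).

(** * The matrices yield the expected equations and outputs *)

Lemma card_ltpairs n : #|ltpairs n| = (n * n.-1)./2.
Proof.
rewrite -sum1_card -bin2 -bin2_sum big_mkord.
under eq_bigl do rewrite inE.
rewrite -(pair_big_dep xpredT (fun i j : 'I_n => (i < j)%N) (fun _ _ => 1%N)) /=.
rewrite (exchange_big_dep xpredT) //=; apply: eq_bigr => j _.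
by rewrite -(big_ord_widen _ (fun=> 1%N) (ltnW (ltn_ord j))) sum1_card card_ord.
Qed.

Lemma rhsE (R : realType) n (s : 'I_n -> 'cV[R]_3) u r t
    (x1 x2 x3 : 'cV[R]_3) (x4 : 'cV[R]_n) (w : 'cV[R]_4) :
  Amx s u r t *m col5 x1 x2 x3 x4 w + Bmx R n *m u t =
  col5 x2 (x3 + u t) 0
    (\col_i (- dotv (s i) x2 / r i t + w 0 0 / r i t))
    (\col_l [:: dotv (u t) x1 + w (inord 1) 0;
                2 * dotv (u t) x2 + 3 * w (inord 2) 0;
                dotv (u t) x3 + w (inord 3) 0;
                0]`_l).
Proof.
rewrite /Amx /Bmx /col5 /row5 !mul_col_mx !mul_row_col !mul0mx !mul1mx.
rewrite !add_col_mx !(add0r, addr0).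
congr (col_mx _ (col_mx _ (col_mx _ (col_mx _ _)))).
  apply/colP => i; rewrite !mxE; congr (_ + _).
    rewrite /dotv mxE -sumrN mulr_suml; apply: eq_bigr => k _.
    by rewrite !mxE !mulNr mulrAC.
  rewrite (bigD1 0) //= big1 ?addr0 => [|l lN0]; first by rewrite !mxE mul1r mulrC.
  by rewrite !mxE (negPf lN0) !mul0r.
apply/colP => l.
have e4E a (v : 'cV[R]_4) : (e4 R a)^T *m v = (v (inord a) 0)%:M.
  by rewrite trmx_delta -rowE; apply/rowP => j; rewrite ord1 !mxE eqxx.
have dotE (v y : 'cV[R]_3) : v^T *m y = (dotv v y)%:M.
  by apply/rowP => j; rewrite ord1 !mxE eqxx mulr1n /dotv mxE.
rewrite !mulmxDl -!scalemxAl -!mulmxA !e4E !dotE !mul_mx_scalar !mxE eqxx !andbT.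
have inE (a b : nat) : (a < 4)%N -> (b < 4)%N ->
    (inord a == inord b :> 'I_4) = (a == b) by move=> *; rewrite -val_eqE /= !inordK.
have [i <-] : exists i : 'I_4, inord i = l by exists l; rewrite inord_val.
case: i => -[|[|[|[|//]]]] lt4 /=; rewrite inordK ?inE //=; ring.
Qed.

Lemma outputE (R : realType) n (s : 'I_n -> 'cV[R]_3) r t
    (x1 x2 x3 : 'cV[R]_3) (x4 : 'cV[R]_n) (w : 'cV[R]_4) :
  Cmx s r t *m col5 x1 x2 x3 x4 w =
  col_mx x4
    (\col_k (2 * dotv (s (pair_fst k) - s (pair_snd k)) x1
                / (r (pair_fst k) t + r (pair_snd k) t)
             + x4 (pair_fst k) 0 - x4 (pair_snd k) 0)).
Proof.
rewrite /Cmx /col5 /row5 !mul_col_mx !mul_row_col !mul0mx !mul1mx !(add0r, addr0).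
congr col_mx; apply/colP => k; rewrite !mxE -addrA; congr (_ + _).
  rewrite /dotv mxE mulr_sumr mulr_suml; apply: eq_bigr => c _.
  by rewrite !mxE mulrAC mulrA.
have pick_row i : \sum_l (l == i)%:R * x4 l 0 = x4 i 0.
  rewrite (bigD1 i) //= eqxx mul1r big1 ?addr0 // => l /negPf->.
  by rewrite mul0r.
under eq_bigr do rewrite mxE mulrBl.
by rewrite sumrB !pick_row.
Qed.

(* Main.v *)
Require Import Defs.
From mathcomp Require Import lra.

Set Implicit Arguments.
Unset Strict Implicit.
Unset Printing Implicit Defensive.

(** The equations are affine in the state once u and the r_i are given, so the
difference d of two solutions with the same output solves the homogeneous system
with zero output, and it suffices that every component of such a d vanishes.

Inside the time interval the ranges are positive, so zero output means that all
the landmarks have the same inner product with the position block d1 at each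
instant; if d1 were nonzero it would be normal to a plane containing them, which
noncoplanarity excludes ([noncoplanar_dotv_eq0]).  The range block d4 is itself
an output, so it is zero as well.  Zeros then propagate along the equations,
because a function that is zero on an interval has zero derivative
([solves_propagate_eq0]).  Writing w0, ..., w3 for the last four components:
d1' = d2 and d2' = d3 give d2 = d3 = 0; then r_i d4i' = - s_i . d2 + w0 gives
w0 = 0 from any one landmark; and since d1, d2 and d3 are zero, the remaining
equations are w0' = w1, w1' = 3 w2 and w2' = w3, whence w1 = w2 = w3 = 0.

An equation may fail at finitely many instants.  This is harmless because the
components are continuous, and a continuous function that is zero off a finite
set is zero everywhere ([within_continuous_eq0]); the same fact carries the
vanishing from the open interval to the initial time. *)

(** An interval rather than a point is produced, so that the induction on D can
go on inside it. *)
Lemma itv_avoid_seq (R : realType) (a b : R) (D : seq R) : a < b ->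
  exists c d : R, [/\ a <= c, c < d, d <= b &
    forall t, c < t < d -> t \notin D].
Proof.
move=> ab; elim: D => [|x D [c [d [ac cd db cdD]]]]; first by exists a, b.
(* Keep the half of ]c, d[ that does not contain x. *)
have [cm md] := midf_lt cd; set m := (c + d) / 2 in cm md.
have [xm|mx] := leP x m.
  exists m, d; split=> // [|t /andP[mt td]]; first exact: le_trans (ltW cm).
  by rewrite inE negb_or gt_eqF ?(le_lt_trans xm)//= cdD// (lt_trans cm)//= td.
exists c, m; split=> // [|t /andP[ct tm]]; first exact: le_trans (ltW md) db.
by rewrite inE negb_or lt_eqF ?(lt_trans tm)//= cdD// ct (lt_trans tm).
Qed.

(** Every neighbourhood of t in [a, b], also at an end point, contains an open
interval, hence a point off D; so f t cannot be nonzero. *)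
Lemma within_continuous_eq0 (R : realType) (a b : R) (D : seq R) (f : R -> R) :
  a < b -> {within `[a, b], continuous f} ->
  (forall t, a < t < b -> t \notin D -> f t = 0) ->
  forall t, a <= t <= b -> f t = 0.
Proof.
move=> ab /subspace_continuousP fC f0 t /andP[at_ tb].
have [//|ft0] := eqVneq (f t) 0.
have ft : f x @[x --> within `[a, b] (nbhs t)] --> f t.
  by apply: fC; rewrite /= in_itv /= at_.
have : \forall x \near within `[a, b] (nbhs t), f x != 0.
  by apply: cvgr_neq0 ft _.
rewrite near_withinE => /nbhs_ballP[e /= e0 fN0].
have cd : Num.max a (t - e) < Num.min b (t + e).
  by rewrite gt_max !lt_min; apply/andP; split; apply/andP; split; lra.
have [c [d [maxc /midf_lt[cm md] dmin cdD]]] := itv_avoid_seq D cd.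
set m := (c + d) / 2 in cm md.
have := le_lt_trans maxc cm; rewrite gt_max => /andP[am tem].
have := lt_le_trans md dmin; rewrite lt_min => /andP[mb mte].
have /fN0 : ball t e m by rewrite -ball_normE /= ltr_distlC; lra.
by rewrite /= in_itv /= !ltW// f0 ?eqxx ?am ?cdD ?cm// => /(_ isT).
Qed.

Lemma solvesB (R : realType) (a b : R) m (x dx y dy : R -> 'cV[R]_m) :
  solves a b x dx -> solves a b y dy ->
  solves a b (fun t => x t - y t) (fun t => dx t - dy t).
Proof.
move=> sx sy k; have [xC [D xD]] := sx k; have [yC [E yE]] := sy k.
have -> : (fun t => (x t - y t) k 0) = (fun t => x t k 0 - y t k 0).
  by apply/funext => t; rewrite !mxE.
split; first by move=> t; apply: cvgB; [exact: xC|exact: yC].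
exists (D ++ E) => t tab; rewrite mem_cat negb_or => /andP[tD tE].
rewrite !mxE; apply: is_deriveB; [exact: xD|exact: yE].
Qed.

Lemma solves_col_mx (R : realType) (a b : R) m1 m2
    (x dx : R -> 'cV[R]_m1) (y dy : R -> 'cV[R]_m2) :
  solves a b (fun t => col_mx (x t) (y t)) (fun t => col_mx (dx t) (dy t)) ->
  solves a b x dx /\ solves a b y dy.
Proof.
move=> sxy; split=> k.
  have [] := sxy (lshift m2 k); have -> :
    (fun t => col_mx (x t) (y t) (lshift m2 k) 0) = (fun t => x t k 0).
    by apply/funext => t; rewrite col_mxEu.
  move=> xC [D xD]; split=> //; exists D => t tab tD.
  by have := xD t tab tD; rewrite col_mxEu.
have [] := sxy (rshift m1 k); have -> :
  (fun t => col_mx (x t) (y t) (rshift m1 k) 0) = (fun t => y t k 0).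
  by apply/funext => t; rewrite col_mxEd.
move=> yC [D yD]; split=> //; exists D => t tab tD.
by have := yD t tab tD; rewrite col_mxEd.
Qed.

(** Differentiating the zero component k of x gives dx t k 0 = 0 where the
equation holds; the last hypothesis turns this into a zero of the component l of
y, and continuity of y covers the finitely many other instants. *)
Lemma solves_propagate_eq0 (R : realType) (a b : R) m p
    (x dx : R -> 'cV[R]_m) (y dy : R -> 'cV[R]_p) (k : 'I_m) (l : 'I_p) :
  a < b ->
  solves a b x dx -> solves a b y dy ->
  (forall t, a <= t <= b -> x t k 0 = 0) ->
  (forall t, a < t < b -> dx t k 0 = 0 -> y t l 0 = 0) ->
  forall t, a <= t <= b -> y t l 0 = 0.
Proof.
move=> ab sx sy x0 dxy; have [_ [D xD]] := sx k; have [yC _] := sy l.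
apply: (within_continuous_eq0 (D := D) ab yC) => t tab tD.
apply: dxy => //; rewrite -(@derive_val _ _ _ _ _ _ _ (xD t tab tD)).
apply: derive_val; apply: near_eq_is_derive (is_derive_cst (0 : R) t 1).
have : \forall v \near t, v \in `]a, b[ by apply: near_in_itvoo; rewrite in_itv.
by apply: filterS => v; rewrite in_itv /= => /andP[av vb]; rewrite x0// !ltW.
Qed.

Lemma dotvC (R : realType) m (v w : 'cV[R]_m) : dotv v w = dotv w v.
Proof. by rewrite /dotv !mxE; apply: eq_bigr => k _; rewrite !mxE mulrC. Qed.

Lemma dotvBl (R : realType) m (v w x : 'cV[R]_m) :
  dotv (v - w) x = dotv v x - dotv w x.
Proof. by rewrite /dotv linearB /= mulmxBl !mxE. Qed.

Lemma dotv0 (R : realType) m (v : 'cV[R]_m) : dotv v 0 = 0.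
Proof. by rewrite /dotv mulmx0 mxE. Qed.

(** A nonzero vector with equal inner products would be normal to a plane that
contains the points. *)
Lemma noncoplanar_dotv_eq0 (R : realType) n (s : 'I_n -> 'cV[R]_3)
    (v : 'cV[R]_3) :
  four_noncoplanar s ->
  (forall i j : 'I_n, (i < j)%N -> dotv (s i - s j) v = 0) ->
  v = 0.
Proof.
move=> [f [_ ncop]] sv; have [//|v0] := eqVneq v 0.
have sE (i j : 'I_n) : dotv v (s i) = dotv v (s j).
  wlog ij : i j / (i < j)%N => [wlog_lt|].
    have [|lt_ji|/val_inj -> //] := ltngtP i j; first exact: wlog_lt.
    by rewrite (wlog_lt j i).
  by apply/eqP; rewrite -subr_eq0 !(dotvC v) -dotvBl sv.
by case: ncop; exists v; split=> //; exists (dotv v (s (f 0))) => k.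
Qed.

Lemma col5_blocks (R : realType) n (x : R -> 'cV[R]_(state_dim n)) :
  exists (x1 x2 x3 : R -> 'cV[R]_3) (x4 : R -> 'cV[R]_n) (w : R -> 'cV[R]_4),
    x = fun t => col5 (x1 t) (x2 t) (x3 t) (x4 t) (w t).
Proof.
exists (fun t => usubmx (x t)), (fun t => usubmx (dsubmx (x t))),
  (fun t => usubmx (dsubmx (dsubmx (x t)))),
  (fun t => usubmx (dsubmx (dsubmx (dsubmx (x t))))),
  (fun t => dsubmx (dsubmx (dsubmx (dsubmx (x t))))).
by apply/funext => t; rewrite /col5 !vsubmxK.
Qed.

Lemma Amx_mul_col5 (R : realType) n (s : 'I_n -> 'cV[R]_3) u r t
    (x1 x2 x3 : 'cV[R]_3) (x4 : 'cV[R]_n) (w : 'cV[R]_4) :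
  Amx s u r t *m col5 x1 x2 x3 x4 w =
  col5 x2 x3 0
    (\col_i (- dotv (s i) x2 / r i t + w 0 0 / r i t))
    (\col_l [:: dotv (u t) x1 + w (inord 1) 0;
                2 * dotv (u t) x2 + 3 * w (inord 2) 0;
                dotv (u t) x3 + w (inord 3) 0;
                0]`_l).
Proof.
apply: (addIr (Bmx R n *m u t)); rewrite rhsE /Bmx /col5 !mul_col_mx.
by rewrite !mul0mx mul1mx !add_col_mx !addr0.
Qed.

Lemma Cmx_mul_eq0 (R : realType) n (s : 'I_n -> 'cV[R]_3) r t
    (x1 x2 x3 : 'cV[R]_3) (x4 : 'cV[R]_n) (w : 'cV[R]_4) :
  Cmx s r t *m col5 x1 x2 x3 x4 w = 0 ->
  x4 = 0 /\ forall i j : 'I_n, (i < j)%N -> r i t + r j t != 0 ->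
    dotv (s i - s j) x1 = 0.
Proof.
rewrite outputE -(@col_mx0 _ n #|ltpairs n| 1) => /eq_col_mx[-> y0].
split=> // i j ij rij.
have ijP : (i, j) \in ltpairs n by rewrite inE.
have /matrixP/(_ (enum_rank_in ijP (i, j)) 0) := y0.
rewrite !mxE /pair_fst /pair_snd enum_rankK_in //= addr0 subr0 => /eqP.
by rewrite mulf_eq0 invr_eq0 (negPf rij) orbF mulf_eq0 pnatr_eq0 /= => /eqP.
Qed.

Theorem theorem1 (R : realType) (n : nat) (s : 'I_n -> 'cV[R]_3)
  (t0 tf : R) (u : R -> 'cV[R]_3) (r : 'I_n -> R -> R) :
  (4 <= n)%N ->
  four_noncoplanar s ->
  t0 < tf ->
  input_signal t0 u ->
  range_signals s t0 u r ->
  (exists rm : R, 0 < rm /\ forall i t, t0 < t -> rm <= r i t) ->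
  observable (Amx s u r) (Bmx R n) (Cmx s r) u t0 tf.
Proof.
move=> n4 ncop t0f _ _ [rm [rm0 rmr]] x z sx sz yxz.
have rgt0 i t : t0 < t < tf -> 0 < r i t.
  by move=> /andP[/(rmr i) + _]; exact: lt_le_trans.
have := solvesB sx sz.
have : forall t, t0 <= t <= tf -> Cmx s r t *m (x t - z t) = 0.
  by move=> t /yxz; rewrite mulmxBr => ->; rewrite subrr.
rewrite (_ : (fun t => _ - (_ + _)) = fun t => Amx s u r t *m (x t - z t));
  last by apply/funext => t; rewrite mulmxBr opprD addrACA subrr addr0.
suff d0 (d : R -> 'cV[R]_(state_dim n)) :
    (forall t, t0 <= t <= tf -> Cmx s r t *m d t = 0) ->
    solves t0 tf d (fun t => Amx s u r t *m d t) -> d t0 = 0.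
  by move=> y0 /(d0 (fun t => x t - z t) y0)/eqP; rewrite subr_eq0 => /eqP.
have [x1 [x2 [x3 [x4 [w ->]]]]] := col5_blocks d => y0.
under [X in solves _ _ _ X]eq_fun do rewrite Amx_mul_col5.
move=> /solves_col_mx[s1 /solves_col_mx[s2 /solves_col_mx[s3]]].
move=> /solves_col_mx[s4 sw].
have cl t : t0 < t < tf -> t0 <= t <= tf by move=> /andP[? ?]; rewrite !ltW.
have x40 t : t0 <= t <= tf -> x4 t = 0 by move=> /y0/Cmx_mul_eq0[].
have x10 k t : t0 <= t <= tf -> x1 t k 0 = 0.
  have [x1C _] := s1 k.
  apply: (within_continuous_eq0 (D := [::]) t0f x1C) => {}t tb _.
  rewrite (noncoplanar_dotv_eq0 ncop (v := x1 t)) ?mxE// => i j ij.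
  have /y0/Cmx_mul_eq0[_] := cl t tb; apply=> //.
  by rewrite gt_eqF ?addr_gt0 ?rgt0.
have x20 k : forall t, t0 <= t <= tf -> x2 t k 0 = 0.
  exact: (solves_propagate_eq0 t0f s1 s2 (x10 k)).
have x30 k : forall t, t0 <= t <= tf -> x3 t k 0 = 0.
  exact: (solves_propagate_eq0 t0f s2 s3 (x20 k)).
have vec0 m (v : R -> 'cV[R]_m) t :
    (forall k t, t0 <= t <= tf -> v t k 0 = 0) -> t0 <= t <= tf -> v t = 0.
  by move=> v0 tb; apply/colP => k; rewrite v0 // mxE.
have w00 : forall t, t0 <= t <= tf -> w t 0 0 = 0.
  pose i0 := Ordinal (ltnW (ltnW (ltnW n4))).
  have x400 t : t0 <= t <= tf -> x4 t i0 0 = 0 by move=> /x40 ->; rewrite mxE.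
  apply: (solves_propagate_eq0 t0f s4 sw x400) => t tb /eqP.
  rewrite mxE (vec0 _ x2) ?cl// dotv0 oppr0 mul0r add0r mulf_eq0 invr_eq0.
  by rewrite (gt_eqF (rgt0 i0 t tb)) orbF => /eqP.
have w10 : forall t, t0 <= t <= tf -> w t (inord 1) 0 = 0.
  apply: (solves_propagate_eq0 t0f sw sw w00) => t tb.
  by rewrite mxE /= (vec0 _ x1) ?cl// dotv0 add0r.
have w20 : forall t, t0 <= t <= tf -> w t (inord 2) 0 = 0.
  apply: (solves_propagate_eq0 t0f sw sw w10) => t tb /eqP.
  rewrite mxE inordK //= (vec0 _ x2) ?cl// dotv0 mulr0 add0r.
  by rewrite mulf_eq0 pnatr_eq0 => /eqP.
have w30 : forall t, t0 <= t <= tf -> w t (inord 3) 0 = 0.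
  apply: (solves_propagate_eq0 t0f sw sw w20) => t tb.
  by rewrite mxE inordK //= (vec0 _ x3) ?cl// dotv0 add0r.
have t0b : t0 <= t0 <= tf by rewrite lexx ltW.
rewrite (vec0 _ x1)// (vec0 _ x2)// (vec0 _ x3)// x40//.
rewrite (_ : w t0 = 0) /col5 ?col_mx0//.
apply/colP => l; rewrite mxE -[l]inord_val.
case: l => -[|[|[|[|//]]]] /= _; [|exact: w10|exact: w20|exact: w30].
by rewrite (_ : inord 0 = 0) ?w00//; apply/val_inj; rewrite /= inordK.
Qed.
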